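(* (1) Any tract $(G,N_G)$ gives rise to a triple of the form $(\mathcal A=\mathbb N[G],\,G,\,(-))$, with $\mathcal T=G$ a group, such that $G$ is uniquely quasi-negated over $N_G$. When the tract is an idyll, i.e. $N_G$ is a $G$-sub-bimodule of $\mathbb N[G]$, it also gives rise to a system $(\mathcal A=\mathbb N[G],\,G,\,(-),\,\preceq_{\mathcal I})$ where $\mathcal I=N_G$. This gives a faithful functor from such tracts (idylls) to the category of semiring systems with $\preceq$-morphisms. (2) Conversely, any system of the form $(\mathcal A=\mathbb N[G],\,G,\,(-),\,\preceq)$, with $G=\mathcal T$ a group, gives rise to an idyll, where $N_G=\{b:0\preceq b\}$.
   Context: **Tracts.** For a group $G$, $\mathbb N[G]$ is the monoid semiring of finite formal sums of elements of $G$ with coefficients in $\mathbb N$. A tract $(G,N_G)$ consists of a group $G$ and a subset $N_G\subseteq\mathbb N[G]$ stable under multiplication by elements of $G$, with $1\notin N_G$, together with a negation $a\mapsto(-)a=\varepsilon a$ given by a distinguished element $\varepsilon=(-)1\in G$, such that $1+(-)1\in N_G$ and $G$ is uniquely quasi-negated over $N_G$: if $a,a'\in G$ and $a+(-)a'\in N_G$ then $a=a'$. An idyll is a tract such that $N_G$ is a $G$-sub-bimodule (additive submonoid stable under left and right multiplication by $G$) of $\mathbb N[G]$. Morphisms of tracts are group homomorphisms $G\to G'$ whose additive extension $\mathbb N[G]\to\mathbb N[G']$ sends $N_G$ into $N_{G'}$. **Systems.** Let $(\mathcal A,+,0)$ be a commutative additive monoid with a subset $\mathcal T\subset\mathcal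 A$, $0\notin\mathcal T$, $\mathcal T_0=\mathcal T\cup\{0\}$. $\mathcal A$ is a $\mathcal T$-gen bimodule if $\mathcal T_0$ is a multiplicative monoid with unit $1\in\mathcal T$, additively generates $\mathcal A$, and acts on $\mathcal A$ on the left with $(a_1a_2)b=a_1(a_2b)$, $0b=0$, $1b=b$, $a1=a$, $a0=0$, $a\sum b_i=\sum ab_i$ ($a,a_i\in\mathcal T_0$, $b,b_i\in\mathcal A$), and likewise on the right. A negation map is an additive isomorphism $(-):\mathcal A\to\mathcal A$ of order $\le2$ with $(-)1\in\mathcal T$ and $((-)a)b=(-)(ab)=a((-)b)$ for $a\in\mathcal T,b\in\mathcal A$ (similarly on the right). Write $b(-)c=b+((-)c)$, $b^\circ=b(-)b$, $\mathcal A^\circ=\{b^\circ\}$. A triple $(\mathcal A,\mathcal T,(-))$ is a $\mathcal T$-gen bimodule with a negation map such that $\mathcal A^\circ\cap\mathcal T=\emptyset$. A surpassing relation $\preceq$ is a reflexive transitive relation with: $b\preceq0\Rightarrow b=0$; $0\preceq b^\circ$; $b_i\preceq b_i'$ ($i=1,2$) implies $a_1b_1+a_2b_2\preceq a_1b_1'+a_2b_2'$ and $b_1a_1+b_2a_2\preceq b_1'a_1+b_2'a_2$ for $a_i\in\mathcal T$ (and $b_1b_2\preceq b_1'b_2'$ when $\mathcal A$ carries a multiplication); $a\preceq a'$ with $a,a'\in\mathcal T_0$ implies $a=a'$. Put $\mathcal A_{\rm Null}=\{b:0\preceq b\}$. A system $(\mathcal A,\mathcal T,(-),\preceq)$ is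 a triple with a surpassing relation such that $a,a'\in\mathcal T$ and $a(-)a'\in\mathcal A_{\rm Null}$ imply $a=a'$; a semiring system is one in which $\mathcal A$ is a semiring whose multiplication restricts to the $\mathcal T_0$-actions. For a $\mathcal T$-sub-bimodule $\mathcal I\supseteq\mathcal A^\circ$, $b_1\preceq_{\mathcal I}b_2$ means $b_2=b_1+c$ for some $c\in\mathcal I$. A $\preceq$-morphism is a map $f:\mathcal A\to\mathcal A'$ restricting to a monoid homomorphism $\mathcal T\to\mathcal T'$ with $f(0)=0'$, $f(ab)=f(a)f(b)$, $f(ba)=f(b)f(a)$ ($a\in\mathcal T,b\in\mathcal A$), $b_1\preceq b_2\Rightarrow f(b_1)\preceq'f(b_2)$ and $f(b_1+b_2)\preceq'f(b_1)+f(b_2)$. *)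

(* Defs.v *)
From HB Require Import structures.
From mathcomp Require Import all_boot ssralg finmap boolp.

Set Implicit Arguments.
Unset Strict Implicit.
Unset Printing Implicit Defensive.

Import GRing.Theory.
Local Open Scope ring_scope.

(* N[G], as finitely supported functions G -> nat. *)
Record formal_sum (G : choiceType) :=
  FormalSum { fsval : {fsfun G -> nat with 0%N} }.

HB.instance Definition _ (G : choiceType) := [isNew for @fsval G].
HB.instance Definition _ (G : choiceType) := [Choice of formal_sum G by <:].

Definition coef (G : choiceType) (b : formal_sum G) (x : G) : nat := fsval b x.
Definition supp (G : choiceType) (b : formal_sum G) : {fset G} :=
  finsupp (fsval b).

Section FormalSums.
Variable G : choiceType.
Implicit Types b c : formal_sum G.

Lemma coef_inj b c : coef b =1 coef c -> b = c.
Proof. by move=> bc; apply: val_inj; apply/fsfunP. Qed.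

Lemma suppN b x : x \notin supp b -> coef b x = 0%N.
Proof. by move=> xb; rewrite /coef fsfun_dflt. Qed.

Definition fs_zero : formal_sum G := FormalSum [fsfun].
Definition fs_add b c : formal_sum G :=
  FormalSum [fsfun x in (supp b `|` supp c)%fset => (coef b x + coef c x)%N].
Definition gen (x : G) : formal_sum G := FormalSum [fsfun y in [fset x]%fset => 1%N].

Lemma coef_zero x : coef fs_zero x = 0%N.
Proof. by rewrite /coef fsfunE. Qed.

Lemma coef_add b c x : coef (fs_add b c) x = (coef b x + coef c x)%N.
Proof.
rewrite {1}/coef fsfunE in_fsetU; case: ifP => // /negbT.
by rewrite negb_or => /andP[/suppN -> /suppN ->].
Qed.

Lemma coef_gen x y : coef (gen x) y = (y == x).
Proof. by rewrite /coef fsfunE in_fset1; case: eqP. Qed.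

Lemma fs_addA : associative fs_add.
Proof. by move=> a b c; apply: coef_inj => x; rewrite !coef_add addnA. Qed.
Lemma fs_addC : commutative fs_add.
Proof. by move=> a b; apply: coef_inj => x; rewrite !coef_add addnC. Qed.
Lemma fs_add0 : left_id fs_zero fs_add.
Proof. by move=> a; apply: coef_inj => x; rewrite coef_add coef_zero. Qed.

HB.instance Definition _ :=
  GRing.isNmodule.Build (formal_sum G) fs_addA fs_addC fs_add0.

Lemma coef0 x : coef (0 : formal_sum G) x = 0%N.
Proof. exact: coef_zero. Qed.

Lemma coefD b c x : coef (b + c) x = (coef b x + coef c x)%N.
Proof. exact: coef_add. Qed.

Lemma coef_sum (I : Type) (r : seq I) (F : I -> formal_sum G) x :
  coef (\sum_(i <- r) F i) x = (\sum_(i <- r) coef (F i) x)%N.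
Proof. exact: (big_morph (fun b => coef b x) (fun b c => coefD b c x) (coef0 x)). Qed.

Lemma coefMn b n x : coef (b *+ n) x = (coef b x * n)%N.
Proof.
by elim: n => [|n IH]; rewrite ?mulr0n ?coef0 ?muln0 // mulrS coefD IH mulnS.
Qed.

(* The additive extension to N[G] of a map from G to a commutative monoid. *)
Definition addext (A : nmodType) (h : G -> A) b : A :=
  \sum_(x <- supp b) h x *+ coef b x.

Lemma addext_sub (A : nmodType) (h : G -> A) b (d : {fset G}) :
  (supp b `<=` d)%fset -> addext h b = \sum_(x <- d) h x *+ coef b x.
Proof.
move=> bd; rewrite /addext; apply: big_fset_incl => // x _ /suppN ->.
exact: mulr0n.
Qed.

Lemma addext0 (A : nmodType) (h : G -> A) : addext h 0 = 0.
Proof. by rewrite /addext big1 // => x _; rewrite coef0 mulr0n. Qed.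

Lemma addextD (A : nmodType) (h : G -> A) : {morph addext h : b c / b + c}.
Proof.
move=> b c; set d := (supp b `|` supp c `|` supp (b + c)%R)%fset.
have bd : (supp b `<=` d)%fset by rewrite /d -fsetUA fsubsetUl.
have cd : (supp c `<=` d)%fset by rewrite /d fsetUAC fsubsetUr.
have bcd : (supp (b + c)%R `<=` d)%fset by rewrite /d fsubsetUr.
rewrite (addext_sub h bd) (addext_sub h cd) (addext_sub h bcd).
rewrite -big_split /=; apply: eq_bigr => x _.
by rewrite coefD mulrnDr.
Qed.

Lemma addext_gen (A : nmodType) (h : G -> A) x : addext h (gen x) = h x.
Proof.
rewrite (@addext_sub _ h _ [fset x]%fset) ?big_seq_fset1 ?coef_gen ?eqxx //.
apply/fsubsetP => y; rewrite in_fset1 mem_finsupp -/(coef _ _) coef_gen.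
by case: (y == x).
Qed.

Lemma formal_sumE b : b = \sum_(x <- supp b) gen x *+ coef b x.
Proof.
apply: coef_inj => y; rewrite coef_sum.
under eq_bigr do rewrite coefMn coef_gen.
case: (boolP (y \in supp b)) => yb.
  rewrite (big_fsetD1 y) //= eqxx mul1n big_seq big1 ?addn0 // => x.
  by rewrite in_fsetD1 eq_sym => /andP[/negbTE ->].
rewrite suppN // big_seq big1 // => x xb.
by case: eqP xb yb => // -> ->.
Qed.

Lemma formal_sum_ind (P : formal_sum G -> Prop) :
  P 0 -> (forall x b, P b -> P (gen x + b)) -> forall b, P b.
Proof.
move=> P0 PS b; rewrite (formal_sumE b).
elim: (enum_fset _) => [|x s IH]; rewrite ?big_nil // big_cons.
by elim: (coef b x) => [|n IHn]; rewrite ?mulr0n ?add0r // mulrS -addrA; apply: PS.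
Qed.

Lemma addext_uniq (A : nmodType) (f g : formal_sum G -> A) :
  f 0 = g 0 -> {morph f : b c / b + c} -> {morph g : b c / b + c} ->
  (forall x, f (gen x) = g (gen x)) -> f =1 g.
Proof.
move=> fg0 fD gD fg b; elim/formal_sum_ind: b => // x b IH.
by rewrite fD gD fg IH.
Qed.

End FormalSums.

(* The additive extension N[G] -> N[H] of a map G -> H. *)
Definition fs_map (G H : choiceType) (f : G -> H) : formal_sum G -> formal_sum H :=
  addext (fun x => gen (f x)).

Lemma fs_map_id (G : choiceType) (b : formal_sum G) : fs_map id b = b.
Proof.
apply: (@addext_uniq _ _ _ id); rewrite /fs_map ?addext0 //; first exact: addextD.
by move=> x; rewrite addext_gen.
Qed.

Lemma fs_map_comp (G H K : choiceType) (f : H -> K) (g : G -> H) b :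
  fs_map (f \o g) b = fs_map f (fs_map g b).
Proof.
apply: (@addext_uniq _ _ _ (fs_map f \o fs_map g)) => [|||x];
  rewrite /fs_map /= ?addext0 ?addext_gen //; first exact: addextD.
by move=> c d; rewrite /= !addextD.
Qed.

Section MonoidSemiring.
Variable G : monoidType.
Implicit Types b c : formal_sum G.

Definition fs_one : formal_sum G := gen 1%g.
Definition fs_mul b c : formal_sum G :=
  addext (fun x => addext (fun y => gen (x * y)%g) c) b.

Lemma fs_mul0l : left_zero 0 fs_mul.
Proof. by move=> b; rewrite /fs_mul addext0. Qed.

Lemma fs_mulDl : left_distributive fs_mul +%R.
Proof. by move=> a b c; rewrite /fs_mul addextD. Qed.

Lemma fs_mul_genl x c : fs_mul (gen x) c = addext (fun y => gen (x * y)%g) c.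
Proof. by rewrite /fs_mul addext_gen. Qed.

Lemma fs_mul_gen x y : fs_mul (gen x) (gen y) = gen (x * y)%g.
Proof. by rewrite fs_mul_genl addext_gen. Qed.

Lemma fs_mulDr : right_distributive fs_mul +%R.
Proof.
move=> a b c; elim/formal_sum_ind: a => [|x a IH]; first by rewrite !fs_mul0l addr0.
by rewrite !fs_mulDl IH !fs_mul_genl addextD addrACA.
Qed.

Lemma fs_mul0r : right_zero 0 fs_mul.
Proof.
move=> a; elim/formal_sum_ind: a => [|x a IH]; first by rewrite fs_mul0l.
by rewrite fs_mulDl IH fs_mul_genl addext0 addr0.
Qed.

Lemma fs_mulA : associative fs_mul.
Proof.
move=> a b c; elim/formal_sum_ind: a => [|x a IH]; first by rewrite !fs_mul0l.
rewrite !fs_mulDl IH; congr (_ + _) => {a IH}.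
elim/formal_sum_ind: b => [|y b IHb]; first by rewrite fs_mul0r !fs_mul0l fs_mul0r.
rewrite !fs_mulDr !fs_mulDl fs_mulDr IHb; congr (_ + _) => {b IHb}.
elim/formal_sum_ind: c => [|z c IHc]; first by rewrite !fs_mul0r.
by rewrite !fs_mulDr IHc !fs_mul_gen mulgA.
Qed.

Lemma fs_mul1l : left_id fs_one fs_mul.
Proof.
move=> a; elim/formal_sum_ind: a => [|x a IH]; first exact: fs_mul0r.
by rewrite fs_mulDr IH fs_mul_gen mul1g.
Qed.

Lemma fs_mul1r : right_id fs_one fs_mul.
Proof.
move=> a; elim/formal_sum_ind: a => [|x a IH]; first exact: fs_mul0l.
by rewrite fs_mulDl IH fs_mul_gen mulg1.
Qed.

HB.instance Definition _ :=
  GRing.Nmodule_isPzSemiRing.Build (formal_sum G)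
    fs_mulA fs_mul1l fs_mul1r fs_mulDl fs_mulDr fs_mul0l fs_mul0r.

Lemma genM x y : gen (x * y)%g = gen x * gen y :> formal_sum G.
Proof. by rewrite -fs_mul_gen. Qed.

Lemma gen1 : gen 1%g = 1 :> formal_sum G.
Proof. by []. Qed.

End MonoidSemiring.

(* The copy of G inside N[G]. *)
Definition gens (G : choiceType) (b : formal_sum G) : Prop := exists x : G, b = gen x.

Definition adjoin0 (A : nmodType) (T : A -> Prop) (a : A) : Prop := T a \/ a = 0.

(* The operations attached to a subset T of A.  They are total functions, but
   only their values with the T_0-argument(s) in T_0 are ever constrained:
   both arguments of tmul, the first of lact, the second of ract. *)
Record tops (A : Type) := TOps {
  tone : A;
  tmul : A -> A -> A;
  lact : A -> A -> A;
  ract : A -> A -> A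
}.

Definition semiring_ops (A : pzSemiRingType) : tops A := TOps 1 *%R *%R *%R.

Section Systems.
Variables (A : nmodType) (T : A -> Prop) (o : tops A).
Local Notation T0 := (adjoin0 T).
Local Notation e := (tone o).

Record gen_bimodule : Prop := GenBimodule {
  gb_T0 : ~ T 0;
  gb_one : T e;
  gb_closed : forall a1 a2, T0 a1 -> T0 a2 -> T0 (tmul o a1 a2);
  gb_mulA : forall a1 a2 a3, T0 a1 -> T0 a2 -> T0 a3 ->
    tmul o a1 (tmul o a2 a3) = tmul o (tmul o a1 a2) a3;
  gb_mul1l : forall a, T0 a -> tmul o e a = a;
  gb_mul1r : forall a, T0 a -> tmul o a e = a;
  gb_generates : forall b, exists s : seq A,
    (forall a, a \in s -> T0 a) /\ b = \sum_(a <- s) a;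
  gb_lactM : forall a1 a2 b, T0 a1 -> T0 a2 ->
    lact o (tmul o a1 a2) b = lact o a1 (lact o a2 b);
  gb_lact0 : forall b, lact o 0 b = 0;
  gb_lact1 : forall b, lact o e b = b;
  gb_lact_one : forall a, T0 a -> lact o a e = a;
  gb_lact_zero : forall a, T0 a -> lact o a 0 = 0;
  gb_lactD : forall a b1 b2, T0 a -> lact o a (b1 + b2) = lact o a b1 + lact o a b2;
  gb_ractM : forall a1 a2 b, T0 a1 -> T0 a2 ->
    ract o b (tmul o a1 a2) = ract o (ract o b a1) a2;
  gb_ract0 : forall b, ract o b 0 = 0;
  gb_ract1 : forall b, ract o b e = b;
  gb_ract_one : forall a, T0 a -> ract o e a = a;
  gb_ract_zero : forall a, T0 a -> ract o 0 a = 0;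
  gb_ractD : forall a b1 b2, T0 a -> ract o (b1 + b2) a = ract o b1 a + ract o b2 a
}.

Record negation_map (neg : A -> A) : Prop := NegationMap {
  neg_zero : neg 0 = 0;
  neg_add : {morph neg : b c / b + c};
  neg_invol : involutive neg;
  neg_one : T (neg e);
  neg_lactl : forall a b, T a -> lact o (neg a) b = neg (lact o a b);
  neg_lactr : forall a b, T a -> lact o a (neg b) = neg (lact o a b);
  neg_ractl : forall a b, T a -> ract o (neg b) a = neg (ract o b a);
  neg_ractr : forall a b, T a -> ract o b (neg a) = neg (ract o b a)
}.

Definition quasi_zero (neg : A -> A) (b : A) : Prop := exists c, b = c + neg c.

Record triple (neg : A -> A) : Prop := Triple {
  triple_gb : gen_bimodule;
  triple_neg : negation_map neg;
  triple_disj : forall b, quasi_zero neg b -> ~ T b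
}.

(* Compatibility with a multiplication of A, when there is one, is added in
   [semiring_system] below. *)
Record surpassing (neg : A -> A) (prec : A -> A -> Prop) : Prop := Surpassing {
  sp_refl : forall b, prec b b;
  sp_trans : forall b c d, prec b c -> prec c d -> prec b d;
  sp_zero : forall b, prec b 0 -> b = 0;
  sp_circ : forall b, prec 0 (b + neg b);
  sp_lact : forall a1 a2 b1 b2 b1' b2', T a1 -> T a2 -> prec b1 b1' -> prec b2 b2' ->
    prec (lact o a1 b1 + lact o a2 b2) (lact o a1 b1' + lact o a2 b2');
  sp_ract : forall a1 a2 b1 b2 b1' b2', T a1 -> T a2 -> prec b1 b1' -> prec b2 b2' ->
    prec (ract o b1 a1 + ract o b2 a2) (ract o b1' a1 + ract o b2' a2);
  sp_tangible : forall a a', T0 a -> T0 a' -> prec a a' -> a = a'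
}.

Definition A_Null (prec : A -> A -> Prop) (b : A) : Prop := prec 0 b.

Definition uniquely_quasi_negated (neg : A -> A) (N : A -> Prop) : Prop :=
  forall a a', T a -> T a' -> N (a + neg a') -> a = a'.

Record system (neg : A -> A) (prec : A -> A -> Prop) : Prop := System {
  sys_triple : triple neg;
  sys_surpassing : surpassing neg prec;
  sys_uqn : uniquely_quasi_negated neg (A_Null prec)
}.

Record sub_bimodule (I : A -> Prop) : Prop := SubBimodule {
  sb_zero : I 0;
  sb_add : forall b c, I b -> I c -> I (b + c);
  sb_lact : forall a b, T a -> I b -> I (lact o a b);
  sb_ract : forall a b, T a -> I b -> I (ract o b a)
}.

Definition prec_of (I : A -> Prop) (b1 b2 : A) : Prop := exists c, I c /\ b2 = b1 + c.

Definition tangible_group : Prop :=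
  (forall a1 a2, T a1 -> T a2 -> T (tmul o a1 a2)) /\
  (forall a, T a -> exists a', [/\ T a', tmul o a a' = e & tmul o a' a = e]).

End Systems.

Record semiring_system (A : pzSemiRingType) (T : A -> Prop) (neg : A -> A)
    (prec : A -> A -> Prop) : Prop := SemiringSystem {
  ss_system : system T (semiring_ops A) neg prec;
  ss_mul : forall b1 b2 b1' b2' : A,
    prec b1 b1' -> prec b2 b2' -> prec (b1 * b2) (b1' * b2')
}.

Record prec_morphism (A A' : nmodType) (T : A -> Prop) (T' : A' -> Prop)
    (o : tops A) (o' : tops A') (prec : A -> A -> Prop) (prec' : A' -> A' -> Prop)
    (f : A -> A') : Prop := PrecMorphism {
  pm_T : forall a, T a -> T' (f a);
  pm_one : f (tone o) = tone o';
  pm_tmul : forall a1 a2, T a1 -> T a2 -> f (tmul o a1 a2) = tmul o' (f a1) (f a2);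
  pm_zero : f 0 = 0;
  pm_lact : forall a b, T a -> f (lact o a b) = lact o' (f a) (f b);
  pm_ract : forall a b, T a -> f (ract o b a) = ract o' (f b) (f a);
  pm_prec : forall b1 b2, prec b1 b2 -> prec' (f b1) (f b2);
  pm_add : forall b1 b2, prec' (f (b1 + b2)) (f b1 + f b2)
}.

(* eps is the distinguished element (-)1, and (-)a = eps a. *)
Record is_tract (G : groupType) (N : formal_sum G -> Prop) (eps : G) : Prop := IsTract {
  tract_mull : forall (a : G) b, N b -> N (gen a * b);
  tract_mulr : forall (a : G) b, N b -> N (b * gen a);
  tract_one : ~ N (gen 1%g);
  tract_eps : N (gen 1%g + gen eps);
  tract_uqn : forall a a' : G, N (gen a + gen (eps * a')%g) -> a = a'
}.

Record is_idyll (G : groupType) (N : formal_sum G -> Prop) (eps : G) : Prop := IsIdyll {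
  idyll_tract : is_tract N eps;
  idyll_sub : sub_bimodule (@gens G) (semiring_ops (formal_sum G)) N
}.

(* The additive extension to N[G] of the negation of a tract. *)
Definition tract_neg (G : groupType) (eps : G) : formal_sum G -> formal_sum G :=
  fs_map (fun a : G => (eps * a)%g).

Record category := Category {
  obj :> Type;
  mor : obj -> obj -> Type;
  idm : forall x, mor x x;
  cmp : forall x y z, mor y z -> mor x y -> mor x z;
  cmp1m : forall x y (f : mor x y), cmp (idm y) f = f;
  cmpm1 : forall x y (f : mor x y), cmp f (idm x) = f;
  cmpA : forall x y z w (h : mor z w) (g : mor y z) (f : mor x y),
    cmp h (cmp g f) = cmp (cmp h g) f
}.

Section Functors.
Variables (C D : category) (F : C -> D).
Variable F1 : forall x y : C, mor x y -> mor (F x) (F y).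

Definition is_functor : Prop :=
  (forall x : C, F1 (idm x) = idm (F x)) /\
  (forall (x y z : C) (g : mor y z) (f : mor x y), F1 (cmp g f) = cmp (F1 g) (F1 f)).

Definition faithful : Prop := forall x y : C, injective (@F1 x y).

End Functors.

Record idyll := Idyll {
  idyll_group : groupType;
  idyll_null : formal_sum idyll_group -> Prop;
  idyll_eps : idyll_group;
  idyllP : is_idyll idyll_null idyll_eps
}.

Record idyll_hom (X Y : idyll) := IdyllHom {
  idyll_fun : idyll_group X -> idyll_group Y;
  idyll_funM : {morph idyll_fun : a b / (a * b)%g};
  idyll_funN : forall b, @idyll_null X b -> @idyll_null Y (fs_map idyll_fun b)
}.

Lemma idyll_hom_eq (X Y : idyll) (f g : idyll_hom X Y) :
  idyll_fun f =1 idyll_fun g -> f = g.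
Proof.
case: f g => [f fM fN] [g gM gN] /= /funext fg; subst g.
by congr IdyllHom; apply: Prop_irrelevance.
Qed.

Lemma idyll_id_subproof (X : idyll) b :
  @idyll_null X b -> @idyll_null X (fs_map id b).
Proof. by rewrite fs_map_id. Qed.

Definition idyll_id (X : idyll) : idyll_hom X X :=
  @IdyllHom X X id (fun a b => erefl) (@idyll_id_subproof X).

Section IdyllComp.
Variables (X Y Z : idyll) (g : idyll_hom Y Z) (f : idyll_hom X Y).

Lemma idyll_comp_subproofM :
  {morph idyll_fun g \o idyll_fun f : a b / (a * b)%g}.
Proof. by move=> a b; rewrite /= !idyll_funM. Qed.

Lemma idyll_comp_subproofN b :
  @idyll_null X b -> @idyll_null Z (fs_map (idyll_fun g \o idyll_fun f) b).
Proof. by move=> Nb; rewrite fs_map_comp; do 2!apply: idyll_funN. Qed.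

Definition idyll_comp : idyll_hom X Z :=
  IdyllHom idyll_comp_subproofM idyll_comp_subproofN.

End IdyllComp.

Definition Idylls : category.
Proof.
by refine (@Category idyll idyll_hom idyll_id idyll_comp _ _ _);
  move=> *; apply: idyll_hom_eq.
Defined.

Record ssystem := SSystem {
  ss_ring : pzSemiRingType;
  ss_T : ss_ring -> Prop;
  ss_neg : ss_ring -> ss_ring;
  ss_prec : ss_ring -> ss_ring -> Prop;
  ssystemP : semiring_system ss_T ss_neg ss_prec
}.

Definition ss_morphism (S S' : ssystem) (f : ss_ring S -> ss_ring S') : Prop :=
  prec_morphism (@ss_T S) (@ss_T S') (semiring_ops (ss_ring S))
    (semiring_ops (ss_ring S')) (@ss_prec S) (@ss_prec S') f.

Record ss_hom (S S' : ssystem) := SSHom {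
  ss_fun : ss_ring S -> ss_ring S';
  ss_funP : ss_morphism ss_fun
}.

Lemma ss_hom_eq (S S' : ssystem) (f g : ss_hom S S') : ss_fun f =1 ss_fun g -> f = g.
Proof.
case: f g => [f fP] [g gP] /= /funext fg; subst g.
by congr SSHom; apply: Prop_irrelevance.
Qed.

Lemma ss_id_subproof (S : ssystem) : @ss_morphism S S id.
Proof.
case: (ssystemP S) => -[_ sp _] _.
by split=> //= *; apply: (sp_refl sp).
Qed.

Definition ss_id (S : ssystem) : ss_hom S S := SSHom (ss_id_subproof S).

Lemma ss_comp_subproof (S S' S'' : ssystem) (g : ss_hom S' S'') (f : ss_hom S S') :
  @ss_morphism S S'' (ss_fun g \o ss_fun f).
Proof.
case: f g => [f [fT f1 fM f0 fl fr fp fD]] [g [gT g1 gM g0 gl gr gp gD]] /=.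
case: (ssystemP S'') => -[_ sp _] _.
split=> /=.
- by move=> a /fT /gT.
- by rewrite f1 g1.
- by move=> a b Ta Tb; rewrite fM // gM //; apply: fT.
- by rewrite f0 g0.
- by move=> a b Ta; rewrite fl // gl //; apply: fT.
- by move=> a b Ta; rewrite fr // gr //; apply: fT.
- by move=> a b /fp /gp.
- by move=> a b; apply: (sp_trans sp) (gD _ _); apply/gp/fD.
Qed.

Definition ss_comp (S S' S'' : ssystem) (g : ss_hom S' S'') (f : ss_hom S S') :
  ss_hom S S'' := SSHom (ss_comp_subproof g f).

Definition SemiringSystems : category.
Proof.
by refine (@Category ssystem ss_hom ss_id ss_comp _ _ _);
  move=> *; apply: ss_hom_eq.
Defined.

(* Main.v *)
Require Import Defs.
From mathcomp Require Import all_boot ssralg.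

Set Implicit Arguments.
Unset Strict Implicit.
Unset Printing Implicit Defensive.
Import GRing.Theory.
Local Open Scope ring_scope.

(** Everything comes from how the distinguished element [eps] sits in [G] and
    from the number of terms of a formal sum.

    Multiplying the relation [1 + eps] of a tract by group elements gives
    further relations [a + a eps] and [eps^-1 + 1], and unique quasi-negation
    turns them into equations in [G]: [eps] is central ([tract_eps_central]) and
    [eps * eps = 1] ([tract_eps_invol]).  The extended negation is
    multiplication by the element [eps] of the semiring [N[G]]
    ([tract_negE]), so these two equations are exactly what makes it a
    negation map.

    The number of terms ([mass]) is additive, and the negation preserves it.
    So a quasi-zero has an even number of terms and is never an element of
    [G]; and a sum that vanishes, or that has a single term, has no nontrivial
    decomposition.  The latter gives the two conditions on the surpassing
    relation [b1 <= b1 + c], [c] in [N], that concern [0] and the elements of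
    [G].  The case [0 <= a] is excluded by inverting [a]: it would put [1] in
    [N].

    Since [G] additively generates [N[G]], the null set of an idyll is a
    two-sided ideal of [N[G]] ([sub_bimodule_ideal]); expanding
    [(b1 + c1) * (b2 + c2)] shows that [<=] respects products.  The additive
    extension of a group homomorphism is a semiring morphism, which determines
    the homomorphism because [G] embeds in [N[G]]; hence a faithful functor.

    Conversely, in a system the negation map is multiplication by
    [(-)1], which is tangible, hence an element [eps] of [G]; the axioms of
    an idyll for the set of [b] with [0 <= b] are then read off from those of
    the surpassing relation. *)

(** * Counting the terms of a formal sum *)

Definition mass (G : choiceType) : formal_sum G -> nat := addext (fun _ : G => 1%N).

Section Mass.
Variable G : choiceType.
Implicit Types b c : formal_sum G.

Lemma massD b c : mass (b + c) = (mass b + mass c)%N.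
Proof. exact: addextD. Qed.

Lemma mass_gen (x : G) : mass (gen x) = 1%N.
Proof. exact: addext_gen. Qed.

Lemma mass0 : mass (0 : formal_sum G) = 0%N.
Proof. exact: addext0. Qed.

Lemma mass_eq0 b : mass b = 0%N -> b = 0.
Proof. by elim/formal_sum_ind: b => // x b _; rewrite massD mass_gen. Qed.

Lemma gen_neq0 (x : G) : gen x <> 0.
Proof. by move=> /(congr1 (@mass G)); rewrite mass_gen mass0. Qed.

Lemma gen_inj : injective (@gen G).
Proof.
move=> x y /(congr1 (fun b => coef b x)).
by rewrite !coef_gen eqxx; case: eqP.
Qed.

End Mass.

(** * The additive extension of a map *)

Section FsMap.
Variables G H : choiceType.
Variable f : G -> H.
Implicit Types b c : formal_sum G.

Lemma fs_map0 : fs_map f 0 = 0.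
Proof. exact: addext0. Qed.

Lemma fs_mapD : {morph fs_map f : b c / b + c}.
Proof. exact: addextD. Qed.

Lemma fs_map_gen x : fs_map f (gen x) = gen (f x).
Proof. exact: addext_gen. Qed.

Lemma mass_fs_map b : mass (fs_map f b) = mass b.
Proof.
elim/formal_sum_ind: b => [|x b IH]; first by rewrite fs_map0 !mass0.
by rewrite fs_mapD fs_map_gen !massD IH !mass_gen.
Qed.

End FsMap.

Lemma fs_mapM (G H : monoidType) (f : G -> H) :
  {morph f : x y / (x * y)%g} -> {morph fs_map f : b c / b * c}.
Proof.
move=> fM b c; elim/formal_sum_ind: b => [|x b IHb].
  by rewrite mul0r fs_map0 mul0r.
rewrite mulrDl !fs_mapD IHb mulrDl fs_map_gen; congr (_ + _) => {b IHb}.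
elim/formal_sum_ind: c => [|y c IHc]; first by rewrite mulr0 fs_map0 mulr0.
by rewrite mulrDr !fs_mapD IHc mulrDr -genM !fs_map_gen fM genM.
Qed.

(** * The semiring [N[G]] over the copy of [G] *)

Lemma gens_gen_bimodule (G : monoidType) :
  gen_bimodule (@gens G) (semiring_ops (formal_sum G)).
Proof.
split=> /=.
- by case=> x /esym /gen_neq0.
- by exists 1%g.
- move=> a1 a2 [[x ->]|->]; last by rewrite mul0r; right.
  by case=> [[y ->]|->]; [left; exists (x * y)%g; rewrite genM | right; rewrite mulr0].
- by move=> *; rewrite mulrA.
- by move=> *; rewrite mul1r.
- by move=> *; rewrite mulr1.
- elim/formal_sum_ind => [|x b [s [sT ->]]]; first by exists [::]; rewrite big_nil.
  exists (gen x :: s); rewrite big_cons; split=> // a.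
  by rewrite inE => /orP[/eqP ->|/sT //]; left; exists x.
- by move=> *; rewrite mulrA.
- by move=> *; rewrite mul0r.
- by move=> *; rewrite mul1r.
- by move=> *; rewrite mulr1.
- by move=> *; rewrite mulr0.
- by move=> *; rewrite mulrDr.
- by move=> *; rewrite mulrA.
- by move=> *; rewrite mulr0.
- by move=> *; rewrite mulr1.
- by move=> *; rewrite mul1r.
- by move=> *; rewrite mul0r.
- by move=> *; rewrite mulrDl.
Qed.

Lemma gens_tangible_group (G : groupType) :
  tangible_group (@gens G) (semiring_ops (formal_sum G)).
Proof.
split=> [_ _ [x ->] [y ->]|_ [x ->]] /=; first by exists (x * y)%g; rewrite genM.
by exists (gen x^-1%g); split; rewrite -?genM ?mulgV ?mulVg //; exists x^-1%g.
Qed.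

(** * Tracts *)

(** The negation is a multiplication in [N[G]]; the negation-map axioms reduce
    to ring identities and to the two properties of [eps] below. *)
Lemma tract_negE (G : groupType) (eps : G) b : tract_neg eps b = gen eps * b.
Proof. exact/esym/fs_mul_genl. Qed.

Section Tract.
Variables (G : groupType) (N : formal_sum G -> Prop) (eps : G).
Hypothesis tr : is_tract N eps.

(** [a * (1 + eps)] is null, and [a * eps] is the negative of
    [eps^-1 * a * eps]. *)
Lemma tract_eps_central (a : G) : (eps * a = a * eps)%g.
Proof.
have /(tract_mull tr a) := tract_eps tr.
rewrite mulrDr -!genM mulg1 -(mulVKg eps (a * eps)%g) => /(tract_uqn tr) {1}->.
by rewrite mulVKg.
Qed.

(** [(1 + eps) * eps^-1] is null, and its term [eps^-1] is the negative of
    [eps^-1 * eps^-1]. *)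
Lemma tract_eps_invol : (eps * eps = 1)%g.
Proof.
have /(tract_mulr tr eps^-1%g) := tract_eps tr.
rewrite mulrDl -!genM mul1g mulgV addrC -(mulVKg eps (eps^-1)%g).
by move=> /(tract_uqn tr) e1; apply: invg_inj; rewrite invgM -e1 invg1.
Qed.

Lemma tract_negation_map :
  negation_map (@gens G) (semiring_ops (formal_sum G)) (tract_neg eps).
Proof.
have epsC b : gen eps * b = b * gen eps.
  elim/formal_sum_ind: b => [|x b IH]; first by rewrite mulr0 mul0r.
  by rewrite mulrDr mulrDl IH -!genM tract_eps_central.
split=> /= [|b c|b||a b _|a b _|a b _|a b _]; rewrite ?tract_negE.
- exact: mulr0.
- exact: mulrDr.
- by rewrite mulrA -genM tract_eps_invol gen1 mul1r.
- by exists eps; rewrite mulr1.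
- by rewrite mulrA.
- by rewrite mulrA -epsC mulrA.
- by rewrite mulrA.
- by rewrite mulrA -epsC mulrA.
Qed.

Lemma tract_triple :
  triple (@gens G) (semiring_ops (formal_sum G)) (tract_neg eps).
Proof.
split; [exact: gens_gen_bimodule | exact: tract_negation_map |].
move=> _ [c ->] [x] /(congr1 (@mass G)) /(congr1 odd).
by rewrite mass_gen massD mass_fs_map addnn odd_double.
Qed.

Lemma tract_uniquely_quasi_negated :
  uniquely_quasi_negated (@gens G) (tract_neg eps) N.
Proof.
move=> _ _ [x ->] [y ->]; rewrite tract_negE -genM.
by move=> /(tract_uqn tr) ->.
Qed.

(** Otherwise [1 = gen x^-1 * gen x] would be null. *)
Lemma tract_null_gen x : ~ N (gen x).
Proof.
move=> /(tract_mull tr x^-1%g); rewrite -genM mulVg.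
exact: tract_one tr.
Qed.

End Tract.

(** * Idylls *)

(** Closure under sums extends the stability under [G] to stability under the
    whole semiring that [G] generates. *)
Lemma sub_bimodule_ideal (G : monoidType) (N : formal_sum G -> Prop) :
  sub_bimodule (@gens G) (semiring_ops (formal_sum G)) N ->
  forall b c, N c -> N (b * c) /\ N (c * b).
Proof.
move=> sb b c Nc; elim/formal_sum_ind: b => [|x b [IHl IHr]].
  by rewrite mul0r mulr0; split; apply: (sb_zero sb).
rewrite mulrDl mulrDr; split; apply: (sb_add sb) => //.
  by apply: (sb_lact sb) => //; exists x.
by apply: (sb_ract sb) => //; exists x.
Qed.

Section Idyll.
Variables (G : groupType) (N : formal_sum G -> Prop) (eps : G).
Hypothesis idl : is_idyll N eps.
Let tr : is_tract N eps := idyll_tract idl.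
Let sb := idyll_sub idl.

(** [c + eps * c] is the multiple [(1 + eps) * c] of a null element. *)
Lemma idyll_quasi_zero b : quasi_zero (tract_neg eps) b -> N b.
Proof.
case=> c ->; rewrite tract_negE -{1}(mul1r c) -gen1 -mulrDl.
by case: (sub_bimodule_ideal sb c (tract_eps tr)).
Qed.

Lemma idyll_surpassing :
  surpassing (@gens G) (semiring_ops (formal_sum G)) (tract_neg eps) (prec_of N).
Proof.
have N0 := sb_zero sb; have ND := sb_add sb.
have Nl := sb_lact sb; have Nr := sb_ract sb.
split=> /=.
- by move=> b; exists 0; rewrite addr0.
- move=> b _ _ [c [Nc ->]] [d [Nd ->]].
  by exists (c + d); split; [exact: ND | rewrite addrA].
- move=> b [c [_ /(congr1 (@mass G))]]; rewrite massD mass0 => /esym/eqP.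
  by rewrite addn_eq0 => /andP[/eqP/mass_eq0].
- move=> b; exists (b + tract_neg eps b); rewrite add0r; split=> //.
  by apply: idyll_quasi_zero; exists b.
- move=> a1 a2 b1 b2 _ _ Ta1 Ta2 [c1 [Nc1 ->]] [c2 [Nc2 ->]].
  exists (a1 * c1 + a2 * c2); rewrite !mulrDr addrACA; split=> //.
  by apply: ND; apply: Nl.
- move=> a1 a2 b1 b2 _ _ Ta1 Ta2 [c1 [Nc1 ->]] [c2 [Nc2 ->]].
  exists (c1 * a1 + c2 * a2); rewrite !mulrDl addrACA; split=> //.
  by apply: ND; apply: Nr.
- move=> a a' Ta Ta' [c [Nc a'E]]; case: Ta a'E => [[x ->]|->] a'E.
    suff /mass_eq0 c0 : mass c = 0%N by rewrite a'E c0 addr0.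
    have := congr1 (@mass G) a'E; rewrite massD mass_gen.
    by case: Ta' => [[y ->]|->]; rewrite ?mass_gen ?mass0 // => -[/esym].
  rewrite add0r in a'E; case: Ta' => [[y yE]|//].
  by case: (tract_null_gen tr (x := y)); rewrite -yE a'E.
Qed.

Lemma idyll_semiring_system :
  semiring_system (@gens G) (tract_neg eps) (prec_of N).
Proof.
split; first split.
- exact: tract_triple tr.
- exact: idyll_surpassing.
- move=> a a' Ta Ta' [c [Nc]]; rewrite add0r => cE.
  by apply: (tract_uniquely_quasi_negated tr) => //; rewrite cE.
- move=> b1 b2 _ _ [c1 [Nc1 ->]] [c2 [Nc2 ->]].
  exists (b1 * c2 + c1 * (b2 + c2)); split; last by rewrite mulrDl mulrDr addrA.
  apply: (sb_add sb).
    by case: (sub_bimodule_ideal sb b1 Nc2).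
  by case: (sub_bimodule_ideal sb (b2 + c2) Nc1).
Qed.

End Idyll.

(** * The functor *)

Lemma idyll_hom1 (X Y : idyll) (f : idyll_hom X Y) : idyll_fun f 1%g = 1%g.
Proof.
apply: (mulgI (idyll_fun f 1%g)).
by rewrite -idyll_funM !mulg1.
Qed.

Lemma idyll_hom_prec_morphism (X Y : idyll) (f : idyll_hom X Y) :
  prec_morphism (@gens (idyll_group X)) (@gens (idyll_group Y))
    (semiring_ops _) (semiring_ops _)
    (prec_of (@idyll_null X)) (prec_of (@idyll_null Y)) (fs_map (idyll_fun f)).
Proof.
have fM := fs_mapM (@idyll_funM _ _ f).
split=> /=.
- by move=> _ [x ->]; rewrite fs_map_gen; exists (idyll_fun f x).
- by rewrite -gen1 fs_map_gen idyll_hom1.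
- by move=> *; apply: fM.
- exact: fs_map0.
- by move=> *; apply: fM.
- by move=> *; apply: fM.
- move=> b _ [c [Nc ->]]; exists (fs_map (idyll_fun f) c).
  by split; [apply: idyll_funN | rewrite fs_mapD].
- move=> b c; exists 0; rewrite addr0 fs_mapD; split=> //.
  exact: (sb_zero (idyll_sub (idyllP Y))).
Qed.

(** * From systems back to idylls *)

(** The element [eps] is [(-)1], and [(-)b = ((-)1)b] for all [b]. *)
Lemma semiring_system_idyll (G : groupType)
    (neg : formal_sum G -> formal_sum G)
    (prec : formal_sum G -> formal_sum G -> Prop) :
  semiring_system (@gens G) neg prec ->
  exists eps : G, neg =1 tract_neg eps /\ is_idyll (A_Null prec) eps.
Proof.
case=> -[[gb ng _] sp uqn] pM.
have T1 := gb_one gb.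
have [eps /= negE1] := neg_one ng.
have negE b : neg b = gen eps * b.
  by have := neg_lactl ng b T1; rewrite /= negE1 mul1r.
have NM b c : A_Null prec c -> A_Null prec (b * c) /\ A_Null prec (c * b).
  rewrite /A_Null => Nc; split.
    by rewrite -(mulr0 b); apply: pM => //; apply: (sp_refl sp).
  by rewrite -(mul0r b); apply: pM => //; apply: (sp_refl sp).
exists eps; split; first by move=> b; rewrite negE tract_negE.
split; split.
- by move=> a b /(NM (gen a)) [].
- by move=> a b /(NM (gen a)) [].
- move=> N1; apply: (@gen_neq0 G 1%g); apply/esym.
  by apply: (sp_tangible sp) => //; [right | left; exists 1%g].
- by rewrite /A_Null -[gen eps]mulr1 -negE; apply: (sp_circ sp).
- move=> a a' Naa'; apply: gen_inj.
  by apply: uqn; [exists a | exists a' | rewrite negE -genM].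
- exact: (sp_refl sp).
- move=> b c Nb Nc.
  (* Addition is the combination of two elements with coefficients [1]. *)
  by have := sp_lact sp T1 T1 Nb Nc; rewrite /= !mul1r addr0.
- by move=> a b _ /(NM a) [].
- by move=> a b _ /(NM a) [].
Qed.

Theorem theorem6p10 :
  (* (1), tracts *)
  (forall (G : groupType) (N : formal_sum G -> Prop) (eps : G),
     is_tract N eps ->
     [/\ triple (@gens G) (semiring_ops (formal_sum G)) (tract_neg eps),
         tangible_group (@gens G) (semiring_ops (formal_sum G))
       & uniquely_quasi_negated (@gens G) (tract_neg eps) N]) /\
  (* (1), idylls *)
  (forall (G : groupType) (N : formal_sum G -> Prop) (eps : G),
     is_idyll N eps ->
     (forall b, quasi_zero (tract_neg eps) b -> N b) /\
     semiring_system (@gens G) (tract_neg eps) (prec_of N)) /\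
  (* (1), the faithful functor *)
  (exists (sysP : forall X : Idylls,
             semiring_system (@gens (idyll_group X)) (tract_neg (idyll_eps X))
               (prec_of (@idyll_null X)))
          (morP : forall (X Y : Idylls) (f : mor X Y),
             @ss_morphism (SSystem (sysP X)) (SSystem (sysP Y))
               (fs_map (idyll_fun f))),
     let F (X : Idylls) : SemiringSystems := SSystem (sysP X) in
     let F1 (X Y : Idylls) (f : mor X Y) : mor (F X) (F Y) := SSHom (morP X Y f) in
     is_functor F1 /\ faithful F1) /\
  (* (2) *)
  (forall (G : groupType) (neg : formal_sum G -> formal_sum G)
          (prec : formal_sum G -> formal_sum G -> Prop),
     semiring_system (@gens G) neg prec ->
     exists eps : G, neg =1 tract_neg eps /\ is_idyll (A_Null prec) eps).
Proof.
split; [|split; [|split]].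
- move=> G N eps tr; split.
  + exact: tract_triple tr.
  + exact: gens_tangible_group.
  + exact: tract_uniquely_quasi_negated tr.
- move=> G N eps idl; split; first exact: idyll_quasi_zero.
  exact: idyll_semiring_system.
- exists (fun X => idyll_semiring_system (idyllP X)).
  exists (fun X Y f => idyll_hom_prec_morphism f).
  split; first split.
  + by move=> X; apply: ss_hom_eq => b /=; rewrite fs_map_id.
  + by move=> X Y Z g f; apply: ss_hom_eq => b /=; rewrite fs_map_comp.
  + move=> X Y f g /(congr1 (fun h => ss_fun h)) /= fg.
    apply: idyll_hom_eq => x; apply: gen_inj.
    by rewrite -!fs_map_gen fg.
- exact: semiring_system_idyll.
Qed.
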